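(* Let $\mathbf{P}(x)=(p_0(x)\;\;p_1(x)\;\;p_2(x)\;\cdots)$ be a family of orthogonal polynomials with respect to $\lambda$, with multiplication matrix $X_P$ (so $x\mathbf{P}(x)=\mathbf{P}(x)X_P$), let $\mathbf{Q}(x)=(q_0(x)\;\;q_1(x)\;\;q_2(x)\;\cdots)$ be the orthonormal polynomials in $L^2(\mathbb{R},\mathrm{d}\mu)$, and let $$W_P=\int_{\mathbb{R}}\mathbf{P}(x)^\top\mathbf{P}(x)\,\mathrm{d}\mu(x)$$ be the Gram matrix. Properties of the Gram matrix include: 1. $W_P$ is symmetric and positive-definite; 2. if $W_P=R^\top R$ is a Cholesky factorization, then $\mathbf{P}(x)=\mathbf{Q}(x)R$, and the converse is true (if $\mathbf{P}(x)=\mathbf{Q}(x)R$ with $R$ the upper-triangular matrix of connection coefficients, then $W_P=R^\top R$ is a Cholesky factorization); and 3. $X_P^\top W_P-W_PX_P=0$.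
   Context: $\lambda$ and $\mu$ are positive Borel measures on $\mathbb{R}$ whose supports contain infinitely many points and all of whose moments are finite. $\mathbf{P}(x)$ is the row vector of a family of real polynomials, $\deg p_k=k$, orthogonal with respect to $\langle f,g\rangle_\lambda=\int_{\mathbb{R}}fg\,\mathrm{d}\lambda$ (not necessarily normalized). $X_P$ is the infinite, irreducible, tridiagonal matrix determined by $x\mathbf{P}(x)=\mathbf{P}(x)X_P$. $\mathbf{Q}(x)$ is the row vector of real polynomials with $\deg q_k=k$ and $\int_{\mathbb{R}}q_iq_j\,\mathrm{d}\mu=\delta_{i,j}$. The infinite matrix $W_P$ has entries $\int_{\mathbb{R}}p_ip_j\,\mathrm{d}\mu$, $i,j\ge0$. The connection coefficients between $\mathbf{P}$ and $\mathbf{Q}$ are the entries $R_{k,n}$ of the infinite upper-triangular matrix $R$ with $p_n(x)=\sum_{k=0}^n q_k(x)R_{k,n}$, i.e. $\mathbf{P}(x)=\mathbf{Q}(x)R$. A Cholesky factorization $W_P=R^\top R$ has $R$ upper-triangular with positive diagonal; correspondingly, the sign of each $q_n$ (which orthonormality leaves free) is chosen so that its leading coefficient has the same sign as that of $p_n$. *)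

(* Defs.v *)
From HB Require Import structures.
From mathcomp Require Import all_boot all_order all_algebra.
From mathcomp Require Import all_classical all_reals all_analysis.

Set Implicit Arguments.
Unset Strict Implicit.
Unset Printing Implicit Defensive.

Import Order.TTheory GRing.Theory Num.Theory.
Import numFieldNormedType.Exports.
Local Open Scope classical_set_scope.
Local Open Scope ring_scope.

(** * Positive Borel measures on the line *)

Definition borel_measure (R : realType) : Type :=
  {measure set (measurableTypeR R) -> \bar R}.

Definition measure_support (R : realType) (nu : borel_measure R) : set R :=
  [set x | forall U : set R, open U -> U x -> (0 < nu U)%E].

Definition finite_moments (R : realType) (nu : borel_measure R) : Prop :=
  forall n : nat, nu.-integrable [set: R] (fun x : R => (x ^+ n)%:E).

(** The real number [\int f g dnu]; [Rintegral] returns a junk value for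
    non-integrable integrands, which [finite_moments] rules out. *)
Definition poly_inner (R : realType) (nu : borel_measure R) (f g : {poly R})
    : R :=
  \int[nu]_(x in [set: R]) (f.[x] * g.[x]).

(** * Families of polynomials, viewed as infinite row vectors *)

Definition graded (R : realType) (P : nat -> {poly R}) : Prop :=
  forall k : nat, size (P k) = k.+1.

Definition orthogonal_polynomials (R : realType) (nu : borel_measure R)
    (P : nat -> {poly R}) : Prop :=
  graded P /\ forall i j : nat, i != j -> poly_inner nu (P i) (P j) = 0.

Definition orthonormal_polynomials (R : realType) (nu : borel_measure R)
    (Q : nat -> {poly R}) : Prop :=
  graded Q /\ forall i j : nat, poly_inner nu (Q i) (Q j) = (i == j)%:R.

(** * Infinite matrices *)

Definition infmx (R : realType) : Type := nat -> nat -> R.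

Definition inftr (R : realType) (A : infmx R) : infmx R := fun i j => A j i.

(** In [infmul] and [rowmul], [\sum_(k \in setT)] is the sum of a finitely
    supported family (and [0] when the support is infinite).  They are only used
    for products in which one factor is tridiagonal or upper-triangular in such
    a way that each of these sums has finitely many nonzero terms. *)
Definition infmul (R : realType) (A B : infmx R) : infmx R :=
  fun i j => \sum_(k \in [set: nat]) (A i k * B k j).

Definition rowmul (R : realType) (P : nat -> {poly R}) (A : infmx R)
    : nat -> {poly R} :=
  fun n => \sum_(k \in [set: nat]) (A k n *: P k).

Definition upper_triangular (R : realType) (A : infmx R) : Prop :=
  forall i j : nat, (j < i)%N -> A i j = 0.

Definition tridiagonal (R : realType) (A : infmx R) : Prop :=
  forall i j : nat, (i.+1 < j)%N || (j.+1 < i)%N -> A i j = 0.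

(** A tridiagonal matrix is irreducible when it does not decouple, i.e. when no
    entry next to the diagonal vanishes. *)
Definition irreducible_tridiagonal (R : realType) (A : infmx R) : Prop :=
  tridiagonal A /\ forall i : nat, A i i.+1 != 0 /\ A i.+1 i != 0.

Definition symmetric_infmx (R : realType) (A : infmx R) : Prop :=
  forall i j : nat, A i j = A j i.

(** [v^T A v > 0] for every nonzero vector [v] with finitely many nonzero
    entries, which is where the quadratic form of an arbitrary infinite matrix
    makes sense. *)
Definition positive_definite (R : realType) (A : infmx R) : Prop :=
  forall v : nat -> R,
    finite_set [set i | v i != 0] -> (exists i : nat, v i != 0) ->
    0 < \sum_(i \in [set: nat]) \sum_(j \in [set: nat]) (v i * A i j * v j).

Definition cholesky (R : realType) (W U : infmx R) : Prop :=
  [/\ upper_triangular U,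
      forall n : nat, 0 < U n n
    & forall i j : nat, W i j = infmul (inftr U) U i j].

Definition multiplication_matrix (R : realType) (P : nat -> {poly R})
    (X : infmx R) : Prop :=
  irreducible_tridiagonal X /\ forall n : nat, 'X * P n = rowmul P X n.

Definition gram (R : realType) (nu : borel_measure R) (P : nat -> {poly R})
    : infmx R :=
  fun i j => poly_inner nu (P i) (P j).

Definition connection_coefficients (R : realType) (P Q : nat -> {poly R})
    (U : infmx R) : Prop :=
  upper_triangular U /\ forall n : nat, P n = rowmul Q U n.

(* Main.v *)
Require Import Defs.
From HB Require Import structures.
From mathcomp Require Import all_boot all_order all_algebra.
From mathcomp Require Import all_classical all_reals all_analysis.

Set Implicit Arguments.
Unset Strict Implicit.
Unset Printing Implicit Defensive.

Import Order.TTheory GRing.Theory Num.Theory.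
Import numFieldNormedType.Exports.
Local Open Scope classical_set_scope.
Local Open Scope ring_scope.

(** Expanding polynomials in the orthonormal family Q turns the inner product of
    mu into a sum of products of Fourier coefficients.  Hence the Gram matrix
    factors through the connection coefficients, whose diagonal entries are the
    ratios of leading coefficients and so are positive; this factorization gives
    positive-definiteness, and uniqueness of the Cholesky factorization gives
    the equivalence with P = QR.  The commutation relation is the symmetry of
    multiplication by x with respect to mu. *)

(** Bridge from finitely supported sums to sums over ordinals. The bound [n] may be any one past the
    support, so different sums can be given a common range. *)
Lemma fsumE_ord (V : nmodType) (n : nat) (F : nat -> V) :
  (forall k, (n <= k)%N -> F k = 0) ->
  \sum_(k \in [set: nat]) F k = \sum_(k < n) F k.
Proof.
move=> F0; rewrite fsbig_ord; apply/esym/fsbig_widen => // k [_ /negP] /=.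
by rewrite -leqNgt => /F0.
Qed.

Section PolyInner.
Context {R : realType} {nu : borel_measure R}.
Hypothesis nu_mom : finite_moments nu.
Implicit Types (f g h : {poly R}) (a : R).

Lemma integrable_horner f :
  nu.-integrable [set: R] (EFin \o (fun x : R => f.[x])).
Proof.
apply: (@eq_integrable _ _ _ nu setT measurableT
    (fun x : R => \sum_(i < size f) (f`_i)%:E * (x ^+ i)%:E)%E).
  by move=> x _; rewrite /= horner_coef sumEFin.
by apply: integrable_sum => // i _; exact/integrableZl.
Qed.

Lemma poly_innerC f g : poly_inner nu f g = poly_inner nu g f.
Proof. by apply: eq_Rintegral => x _; rewrite mulrC. Qed.

Lemma poly_innerDl f g h :
  poly_inner nu (f + g) h = poly_inner nu f h + poly_inner nu g h.
Proof.
rewrite /poly_inner -RintegralD //.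
- by apply: eq_Rintegral => x _; rewrite hornerD mulrDl.
- by under eq_fun do rewrite -hornerM; exact: integrable_horner.
- by under eq_fun do rewrite -hornerM; exact: integrable_horner.
Qed.

Lemma poly_innerZl a f g : poly_inner nu (a *: f) g = a * poly_inner nu f g.
Proof.
rewrite /poly_inner -RintegralZl //.
  by apply: eq_Rintegral => x _; rewrite hornerZ mulrA.
by under eq_fun do rewrite -hornerM; exact: integrable_horner.
Qed.

Lemma poly_inner_suml n (c : nat -> R) (F : nat -> {poly R}) g :
  poly_inner nu (\sum_(k < n) c k *: F k) g
  = \sum_(k < n) c k * poly_inner nu (F k) g.
Proof.
rewrite (big_morph (fun f => poly_inner nu f g)
  (fun f h => poly_innerDl f h g) (id1 := 0)).
  by under eq_bigr do rewrite poly_innerZl.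
by rewrite -(scale0r (0 : {poly R})) poly_innerZl mul0r.
Qed.

Lemma poly_inner_sumr n (c : nat -> R) (F : nat -> {poly R}) g :
  poly_inner nu g (\sum_(k < n) c k *: F k)
  = \sum_(k < n) c k * poly_inner nu g (F k).
Proof.
by rewrite poly_innerC poly_inner_suml; under eq_bigr do rewrite poly_innerC.
Qed.

Lemma poly_innerXl f g : poly_inner nu ('X * f) g = poly_inner nu f ('X * g).
Proof. by apply: eq_Rintegral => x _; rewrite !hornerM mulrCA mulrA. Qed.

End PolyInner.

Section Graded.
Context {R : realType} {P : nat -> {poly R}}.
Hypothesis gP : graded P.

Lemma graded_lead_neq0 n : lead_coef (P n) != 0.
Proof. by rewrite lead_coef_eq0 -size_poly_eq0 gP. Qed.

Lemma graded_coef_top n (c : nat -> R) :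
  (\sum_(k < n.+1) c k *: P k)`_n = c n * lead_coef (P n).
Proof.
rewrite big_ord_recr /= coefD coef_sum big1 => [|k _].
  by rewrite add0r coefZ lead_coefE gP.
by rewrite coefZ nth_default ?mulr0 // gP ltn_ord.
Qed.

(** Induction on the degree: [a] is chosen so that [f - a *: P n] loses its coefficient of degree
    [n]. *)
Lemma graded_span n (f : {poly R}) : (size f <= n)%N ->
  exists c : nat -> R, f = \sum_(k < n) c k *: P k.
Proof.
elim: n f => [|n IHn] f szf.
  exists (fun=> 0); rewrite big_ord0; apply/eqP.
  by rewrite -size_poly_eq0 -leqn0.
pose a := f`_n / lead_coef (P n).
have [|c fE] := IHn (f - a *: P n).
  apply/leq_sizeP => j; rewrite leq_eqVlt => /predU1P[<-|nj].
    rewrite coefB coefZ /a; have := graded_lead_neq0 n.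
    by rewrite lead_coefE gP /= => Pn0; rewrite divfK ?subrr.
  by rewrite coefB coefZ !nth_default ?mulr0 ?subr0 ?gP // (leq_trans szf).
(* The induction hypothesis does not constrain [c n], so that value is overridden by [a]. *)
exists (fun k => if k == n then a else c k).
rewrite big_ord_recr /= eqxx -[LHS](subrK (a *: P n)) fE; congr (_ + _).
by apply: eq_bigr => k _; rewrite ltn_eqF.
Qed.

(** Only the last polynomial of the sum reaches the top degree, so its coefficient vanishes and the
    sum shortens. *)
Lemma graded_free n (c : nat -> R) :
  \sum_(k < n) c k *: P k = 0 -> forall k, (k < n)%N -> c k = 0.
Proof.
elim: n => // n IHn sum0.
have cn0 : c n = 0.
  apply/eqP; have := graded_coef_top n c; rewrite sum0 coef0 => /esym/eqP.
  by rewrite mulf_eq0 (negPf (graded_lead_neq0 n)) orbF.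
move: sum0; rewrite big_ord_recr /= cn0 scale0r addr0 => /IHn {}IHn k.
by rewrite ltnS leq_eqVlt => /predU1P[->|/IHn].
Qed.

End Graded.

Section Orthonormal.
Context {R : realType} {mu : borel_measure R} {Q : nat -> {poly R}}.
Hypothesis mu_mom : finite_moments mu.
Hypothesis hQ : orthonormal_polynomials mu Q.

Lemma sum_inner_orthonormal n k (c : nat -> R) : (k < n)%N ->
  \sum_(l < n) c l * poly_inner mu (Q k) (Q l) = c k.
Proof.
move=> kn; rewrite (bigD1 (Ordinal kn)) //= hQ.2 eqxx mulr1 big1 ?addr0 //.
by move=> l; rewrite -val_eqE /= => /negPf lk; rewrite hQ.2 eq_sym lk mulr0.
Qed.

Lemma poly_inner_orthonormal n (a b : nat -> R) :
  poly_inner mu (\sum_(k < n) a k *: Q k) (\sum_(k < n) b k *: Q k)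
  = \sum_(k < n) a k * b k.
Proof.
rewrite poly_inner_suml //; apply: eq_bigr => k _.
by rewrite poly_inner_sumr // sum_inner_orthonormal.
Qed.

(** Parseval: in the coordinates given by [Q] the form is a sum of squares, which vanishes only when
    every coordinate does. *)
Lemma poly_inner_gt0 (f : {poly R}) : f != 0 -> 0 < poly_inner mu f f.
Proof.
have [c fE] := graded_span hQ.1 (leqnn (size f)); rewrite fE => f0.
rewrite poly_inner_orthonormal lt_neqAle sumr_ge0 ?andbT; last first.
  by move=> k _; rewrite -expr2 sqr_ge0.
apply: contra f0 => /eqP/esym/eqP.
rewrite psumr_eq0 => [/allP c0|k _]; last by rewrite -expr2 sqr_ge0.
apply/eqP/big1 => k _; have := c0 k (mem_index_enum k).
by rewrite /= mulf_eq0 orbb => /eqP ->; rewrite scale0r.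
Qed.

End Orthonormal.

Lemma rowmul_upper (R : realType) (Q : nat -> {poly R}) (U : infmx R) n :
  upper_triangular U -> rowmul Q U n = \sum_(k < n.+1) U k n *: Q k.
Proof.
by move=> uU; rewrite /rowmul (@fsumE_ord _ n.+1) // => k /uU ->; rewrite scale0r.
Qed.

(** Columns [i] and [j] of [U] are both nonzero only in rows up to min(i, j). Uniqueness below takes
    [m] to be i + 1, the Gram factorization max(i, j) + 1. *)
Lemma infmul_tr_upper (R : realType) (U : infmx R) m i j :
  upper_triangular U -> (minn i j < m)%N ->
  infmul (inftr U) U i j = \sum_(k < m) U k i * U k j.
Proof.
move=> uU ijm; rewrite /infmul /inftr (@fsumE_ord _ m) // => k mk.
have := leq_trans ijm mk; rewrite gtn_min => /orP[] /uU ->.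
  by rewrite mul0r.
by rewrite mulr0.
Qed.

(** Strong induction on the row: in entry (i, j) of the two factorizations the terms from earlier
    rows agree and cancel, leaving only the products from row [i]. *)
Lemma cholesky_unique (R : realType) (W U V : infmx R) :
  cholesky W U -> cholesky W V -> forall i j, U i j = V i j.
Proof.
move=> [uU U0 WU] [uV V0 WV] i; elim/ltn_ind: i => i IHi.
have row j : U i i * U i j = V i i * V i j.
  have := WU i j; rewrite WV !(@infmul_tr_upper _ _ i.+1) ?ltnS ?geq_minl //.
  rewrite !big_ord_recr /=; under eq_bigr do rewrite -!IHi ?ltn_ord //.
  by move/addrI.
(* At j = i, [row] equates two squares; positivity of the diagonals excludes opposite signs. *)
have diag : U i i = V i i.
  apply/eqP; rewrite -(@eqrXn2 _ 2) ?ltW ?U0 ?V0 //.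
  by rewrite !expr2 row.
move=> j; have := row j; rewrite diag => /mulfI; apply.
by rewrite gt_eqF.
Qed.

Lemma connection_coefficients_exist (R : realType) (P Q : nat -> {poly R}) :
  graded P -> graded Q -> exists U, connection_coefficients P Q U.
Proof.
move=> gP gQ.
have /choice[c cE] n : exists c : nat -> R, P n = \sum_(k < n.+1) c k *: Q k.
  by apply: (graded_span gQ); rewrite gP.
pose U : infmx R := fun k n => if (k <= n)%N then c n k else 0.
(* The values [c n k] with k > n are arbitrary; the cut-off in [U] discards them. *)
have uU : upper_triangular U by move=> i j ji; rewrite /U leqNgt ji.
exists U; split=> // n; rewrite rowmul_upper // cE.
by apply: eq_bigr => k _; rewrite /U -ltnS ltn_ord.
Qed.

Lemma connection_cholesky (R : realType) (mu : borel_measure R)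
    (P Q : nat -> {poly R}) (U : infmx R) :
  finite_moments mu -> graded P -> orthonormal_polynomials mu Q ->
  (forall n, Num.sg (lead_coef (Q n)) = Num.sg (lead_coef (P n))) ->
  connection_coefficients P Q U -> cholesky (gram mu P) U.
Proof.
move=> mom gP hQ hsign [uU PE]; split=> // [n|i j].
  have : lead_coef (P n) = U n n * lead_coef (Q n).
    rewrite -(graded_coef_top hQ.1 n (fun k => U k n)) -rowmul_upper //.
    by rewrite -PE lead_coefE gP.
  (* By the sign convention both leading coefficients have the same nonzero sign, which cancels and
     leaves sign 1 for [U n n]. *)
  move/(congr1 Num.sg); rewrite -hsign sgrM => /esym.
  rewrite -[RHS]mul1r => /mulIf sgU; rewrite -sgr_gt0 sgU ?ltr01 //.
  by rewrite sgr_eq0 (graded_lead_neq0 hQ.1).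
(* A common range for the expansions of [P i] and [P j], as Parseval requires. *)
pose m := (maxn i j).+1.
have PEm n : (n < m)%N -> P n = \sum_(k < m) U k n *: Q k.
  move=> nm; rewrite PE /rowmul (@fsumE_ord _ m) // => k mk.
  by rewrite uU ?scale0r // (leq_trans nm).
rewrite /gram (PEm i) ?(PEm j) ?ltnS ?leq_maxl ?leq_maxr //.
rewrite (poly_inner_orthonormal mom hQ m (U^~ i) (U^~ j)).
by rewrite (@infmul_tr_upper _ _ m) // ltnS (leq_trans (geq_minl _ _)) ?leq_maxl.
Qed.

(** The quadratic form at [v] is the squared norm in L^2(mu) of the polynomial with coordinates [v]
    in [P], which is nonzero because [P] is free. *)
Lemma gram_positive_definite (R : realType) (mu : borel_measure R)
    (P Q : nat -> {poly R}) :
  finite_moments mu -> graded P -> orthonormal_polynomials mu Q ->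
  positive_definite (gram mu P).
Proof.
move=> mom gP hQ v finv [i0 vi0].
(* One more than the largest index in the support of [v]. *)
pose n := (\max_(i <- finmap.enum_fset (fset_set [set i | v i != 0])) i).+1.
have vn k : (n <= k)%N -> v k = 0.
  apply: contraTeq => vk; rewrite -ltnNge ltnS.
  apply: (@leq_bigmax_seq _ _ xpredT id) => //.
  by rewrite in_fset_set // inE.
rewrite (@fsumE_ord _ n) => [|k /vn vk]; last first.
  by apply: fsbig1 => j _; rewrite vk !mul0r.
under eq_bigr => i _.
  rewrite (@fsumE_ord _ n) => [|k /vn ->]; last by rewrite mulr0.
  over.
have -> : \sum_(i < n) \sum_(j < n) v i * gram mu P i j * v j
    = poly_inner mu (\sum_(i < n) v i *: P i) (\sum_(j < n) v j *: P j).
  rewrite poly_inner_suml //; apply: eq_bigr => i _.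
  rewrite poly_inner_sumr // mulr_sumr; apply: eq_bigr => j _.
  by rewrite -mulrA [gram _ _ _ _ * _]mulrC.
apply: (poly_inner_gt0 mom hQ); apply: contra vi0 => /eqP sum0.
have [i0n|/vn -> //] := ltnP i0 n.
by rewrite (graded_free gP sum0).
Qed.

(** Both entries equal the integral of x p_i p_j against mu: one expands x p_i through [X], the
    other x p_j. *)
Lemma gram_mulX (R : realType) (mu : borel_measure R) (P : nat -> {poly R})
    (X : infmx R) :
  finite_moments mu -> multiplication_matrix P X -> forall i j,
  infmul (inftr X) (gram mu P) i j = infmul (gram mu P) X i j.
Proof.
move=> mom [[tX _] XE] i j.
(* Column [n] of [X] stops at row n + 1, so x p_n is a combination of p_0, ..., p_(n+1). *)
have X0 n k : (n.+2 <= k)%N -> X k n = 0 by move=> nk; rewrite tX // nk orbT.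
have XP n : 'X * P n = \sum_(k < n.+2) X k n *: P k.
  by rewrite XE /rowmul (@fsumE_ord _ n.+2) // => k /X0 ->; rewrite scale0r.
transitivity (poly_inner mu ('X * P i) (P j)).
  rewrite XP (poly_inner_suml mom _ (X^~ i)) /infmul (@fsumE_ord _ i.+2) //.
  by move=> k /X0; rewrite /inftr => ->; rewrite mul0r.
rewrite poly_innerXl XP (poly_inner_sumr mom _ (X^~ j)) /infmul.
rewrite (@fsumE_ord _ j.+2) => [|k /X0 ->]; last by rewrite mulr0.
by apply: eq_bigr => k _; rewrite mulrC.
Qed.

Theorem proposition1p2 (R : realType) (lambda mu : borel_measure R)
    (lambda_supp : infinite_set (measure_support lambda))
    (lambda_mom : finite_moments lambda)
    (mu_supp : infinite_set (measure_support mu))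
    (mu_mom : finite_moments mu)
    (P : nat -> {poly R}) (hP : orthogonal_polynomials lambda P)
    (X_P : infmx R) (hX : multiplication_matrix P X_P)
    (Q : nat -> {poly R}) (hQ : orthonormal_polynomials mu Q)
    (hsign : forall n : nat,
       Num.sg (lead_coef (Q n)) = Num.sg (lead_coef (P n))) :
  [/\ symmetric_infmx (gram mu P) /\ positive_definite (gram mu P),
      (forall U : infmx R, cholesky (gram mu P) U ->
         forall n : nat, P n = rowmul Q U n) /\
      (forall U : infmx R, connection_coefficients P Q U ->
         cholesky (gram mu P) U)
    & forall i j : nat,
        infmul (inftr X_P) (gram mu P) i j - infmul (gram mu P) X_P i j = 0].
Proof.
split; last by move=> i j; rewrite (gram_mulX mu_mom hX) subrr.
  split; first by move=> i j; exact: poly_innerC.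
  exact: (gram_positive_definite mu_mom hP.1 hQ).
have chol := @connection_cholesky R mu P Q _ mu_mom hP.1 hQ hsign.
split=> [U cU n|U /chol //].
(* The true connection matrix [S] is itself a Cholesky factor, so uniqueness identifies [U] with
   it. *)
have [S hS] := connection_coefficients_exist hP.1 hQ.1.
have US := cholesky_unique cU (chol _ hS).
by rewrite hS.2 /rowmul; apply: eq_fsbigr => k _; rewrite US.
Qed.
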